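(* Let $d\ge 5$ and let $L(t)$, $t\in I$ ($I\subset\mathbb{R}$ an open interval), be a continuous and universal family of oriented lines in $\mathbb{R}^d$. Then its type is trivial, i.e. it is the identity permutation of $[d-1]$ or its reverse.
   Context: An oriented line in $\mathbb{R}^d$ is an equivalence class of pairs $(a,v)$, $v\ne0$, representing $\{a+sv\}$, with $(a,v)\sim(a+\alpha v,\beta v)$ for $\alpha\in\mathbb{R}$, $\beta>0$. A family $L(t)$, $t\in I$, is continuous if $t\mapsto L(t)$ is continuous in the natural topology of the space of oriented lines (equivalently, writing $L(t)=(a(t),v(t))$ with $v(t)$ a unit vector and $a(t)$ the point of $L(t)$ on $\{x:v(t)\cdot x=0\}$, both $a(t)$, $v(t)$ are continuous). For an ordered $(d-1)$-tuple of oriented lines represented by $(a_i,v_i)$ set $h_i=\det(a_i,v_1,\ldots,v_{d-1})$; the tuple is in general position if the $h_i$ are distinct, and its type is the permutation $\sigma$ of $[d-1]$ with $h_{\sigma(1)}<\dots<h_{\sigma(d-1)}$. The family is universal, of type $\sigma$, if for all $t_1<\dots<t_{d-1}$ in $I$ the tuple $L(t_1),\ldots,L(t_{d-1})$ is in general position and has type $\sigma$. *)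

(* Defs.v *)
From HB Require Import structures.
From mathcomp Require Import all_boot all_order all_algebra perm.
From mathcomp Require Import all_classical all_reals topology normedtype realfun.

Set Implicit Arguments.
Unset Strict Implicit.
Unset Printing Implicit Defensive.

Import Order.TTheory GRing.Theory Num.Theory.
Import numFieldNormedType.Exports.

Local Open Scope classical_set_scope.
Local Open Scope ring_scope.

Definition line_rep (R : realType) (d : nat) : Type :=
  set_type [set p : 'cV[R]_d * 'cV[R]_d | p.2 != 0].

HB.instance Definition _ (R : realType) (d : nat) :=
  Topological.copy (line_rep R d)
    (set_type [set p : 'cV[R]_d * 'cV[R]_d | p.2 != 0]).

Section LineRep.
Variables (R : realType) (d : nat).
Implicit Types p q : line_rep R d.

Definition base p : 'cV[R]_d := (\val p).1.
Definition dir p : 'cV[R]_d := (\val p).2.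

Definition same_line p q : bool :=
  `[< exists alpha beta : R, 0 < beta /\
        base q = base p + alpha *: dir p /\ dir q = beta *: dir p >].

Lemma dir_neq0 p : dir p != 0.
Proof. exact: (set_valP p). Qed.

Lemma same_line_equiv :
  [/\ reflexive same_line, symmetric same_line & transitive same_line].
Proof.
have sym p q : same_line p q -> same_line q p.
  move=> /asboolP[a [b [b0 [Eb Ed]]]]; apply/asboolP.
  exists (- a / b), b^-1; rewrite invr_gt0 Eb Ed !scalerA; split=> //.
  by rewrite divfK ?mulVf ?gt_eqF// scale1r scaleNr addrK.
split.
- move=> p; apply/asboolP; exists 0, 1.
  by rewrite ltr01 scale0r addr0 scale1r.
- by move=> p q; apply/idP/idP; exact: sym.
- move=> q p r /asboolP[a [b [b0 [Eb Ed]]]] /asboolP[a' [b' [b'0 [Eb' Ed']]]].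
  apply/asboolP; exists (a + a' * b), (b' * b); rewrite mulr_gt0//.
  by rewrite Eb' Ed' Eb Ed !scalerA scalerDl addrA.
Qed.

Canonical same_line_equiv_rel :=
  EquivRel same_line (let: And3 r _ _ := same_line_equiv in r)
                     (let: And3 _ s _ := same_line_equiv in s)
                     (let: And3 _ _ t := same_line_equiv in t).

Definition oriented_line : Type :=
  quotient_topology {eq_quot same_line_equiv_rel}%qT.

HB.instance Definition _ := Topological.on oriented_line.
HB.instance Definition _ := Quotient.on oriented_line.

End LineRep.

Section NormalForm.
Variables (R : realType) (d : nat).
Implicit Types p q : line_rep R d.

Definition dotv (u v : 'cV[R]_d) : R := \sum_i u i 0 * v i 0.
Definition unit_dir p : 'cV[R]_d :=
  (Num.sqrt (dotv (dir p) (dir p)))^-1 *: dir p.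
Definition foot p : 'cV[R]_d :=
  base p - dotv (base p) (unit_dir p) *: unit_dir p.

Let dotZl a u v : dotv (a *: u) v = a * dotv u v.
Proof. by rewrite mulr_sumr; apply: eq_bigr => i _; rewrite mxE mulrA. Qed.
Let dotC u v : dotv u v = dotv v u.
Proof. by apply: eq_bigr => i _; rewrite mulrC. Qed.
Let dotDl u u' v : dotv (u + u') v = dotv u v + dotv u' v.
Proof. by rewrite -big_split; apply: eq_bigr => i _; rewrite mxE mulrDl. Qed.
Let dot_gt0 p : 0 < dotv (dir p) (dir p).
Proof.
rewrite lt0r sumr_ge0 ?andbT => [|i _]; last by rewrite -expr2 sqr_ge0.
apply: contraNneq (dir_neq0 p) => /eqP; rewrite psumr_eq0 => [|i _]; last first.
  by rewrite -expr2 sqr_ge0.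
move=> /allP H; apply/eqP/matrixP => i j; rewrite ord1 mxE.
by have /eqP := H i (mem_index_enum _); move=> /eqP; rewrite mulf_eq0 orbb => /eqP.
Qed.

Lemma dot_unit_dir p : dotv (unit_dir p) (unit_dir p) = 1.
Proof.
rewrite dotZl dotC dotZl mulrA -invfM -expr2 sqr_sqrtr ?mulVf// ?gt_eqF//.
exact: ltW.
Qed.

Lemma dot_foot p : dotv (foot p) (unit_dir p) = 0.
Proof. by rewrite dotDl -scaleNr dotZl dot_unit_dir mulr1 subrr. Qed.

Lemma unit_dir_same_line p q : same_line p q -> unit_dir p = unit_dir q.
Proof.
move=> /asboolP[a [b [b0 [_ E]]]]; rewrite /unit_dir E dotZl dotC dotZl mulrA.
rewrite sqrtrM ?mulr_ge0 ?ltW// -expr2 sqrtr_sqr gtr0_norm// scalerA invfM.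
by rewrite mulrAC mulVf ?mul1r// gt_eqF.
Qed.

Lemma foot_same_line p q : same_line p q -> foot p = foot q.
Proof.
move=> pq; have E := unit_dir_same_line pq.
move/asboolP : pq => [a [b [_ [Eb _]]]]; rewrite /foot -E Eb.
have Ed : dir p = Num.sqrt (dotv (dir p) (dir p)) *: unit_dir p.
  by rewrite /unit_dir scalerA divff ?scale1r// gt_eqF// sqrtr_gt0.
have Eu : dotv (dir p) (unit_dir p) *: unit_dir p = dir p.
  rewrite [X in dotv X _]Ed dotZl dot_unit_dir mulr1; exact/esym.
by rewrite dotDl dotZl scalerDl -scalerA Eu opprD addrACA subrr addr0.
Qed.

Lemma unit_dir_neq0 p : unit_dir p != 0.
Proof.
apply: contraNneq (oner_neq0 R) => E; rewrite -(dot_unit_dir p) E.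
by rewrite -(scale0r 0) dotZl mul0r.
Qed.

Lemma foot_unit_dir p : exists a b : R, 0 < b /\
   foot p = base p + a *: dir p /\ unit_dir p = b *: dir p.
Proof.
exists (- dotv (base p) (unit_dir p) * (Num.sqrt (dotv (dir p) (dir p)))^-1).
exists (Num.sqrt (dotv (dir p) (dir p)))^-1; split; last split=> //.
  by rewrite invr_gt0 sqrtr_gt0.
by rewrite -scalerA scaleNr.
Qed.

Lemma mx_continuous (T : topologicalType) m n (f : T -> 'M[R]_(m,n)) :
  (forall i j, continuous (fun x => f x i j)) -> continuous f.
Proof.
move=> cf x A [P xP PA]; apply: (filterS (P := [set y | forall i j, P i j (f y i j)])).
  by move=> y; exact: PA.
apply: filter_forall => i; apply: filter_forall => j; exact/cf/xP.
Qed.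

Lemma entry_continuous (T : topologicalType) m n (f : T -> 'M[R]_(m,n)) i j :
  continuous f -> continuous (fun x => f x i j).
Proof.
move=> cf x A Ax; have := cf x [set M : 'M_(m,n) | A (M i j)]; apply.
exists (fun a b => if (a == i) && (b == j) then A else setT).
  by move=> a b; case: andP => [[/eqP-> /eqP->]//|_]; exact: filterT.
by move=> M /(_ i j); rewrite !eqxx.
Qed.

Lemma line_rep_val_continuous : continuous (fun p : line_rep R d => \val p).
Proof. exact: initial_continuous. Qed.
Lemma base_continuous : continuous (@base R d).
Proof. by move=> p; apply: cvg_comp; [exact: line_rep_val_continuous|exact: cvg_fst]. Qed.
Lemma dir_continuous : continuous (@dir R d).
Proof. by move=> p; apply: cvg_comp; [exact: line_rep_val_continuous|exact: cvg_snd]. Qed.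

Lemma dotv_continuous (T : topologicalType) (f g : T -> 'cV[R]_d) :
  continuous f -> continuous g -> continuous (fun x => dotv (f x) (g x)).
Proof.
move=> cf cg x; rewrite /continuous_at /dotv; elim: (index_enum _) => [|i r IH].
  by rewrite big_nil; under eq_fun do rewrite big_nil; exact: cvg_cst.
rewrite big_cons; under eq_fun do rewrite big_cons.
apply: cvgD => //; by apply: cvgM; [exact: (entry_continuous cf)|exact: (entry_continuous cg)].
Qed.

Lemma unit_dir_continuous : continuous unit_dir.
Proof.
have cs : continuous (fun p => (Num.sqrt (dotv (dir p) (dir p)))^-1).
  move=> p; apply: (@cvgV R _ (nbhs p) _ (fun p => Num.sqrt (dotv (dir p) (dir p)))).
    by rewrite gt_eqF// sqrtr_gt0.
  apply: (@continuous_comp _ _ _ (fun p => dotv (dir p) (dir p)) Num.sqrt).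
    exact: (dotv_continuous dir_continuous dir_continuous).
  exact: sqrt_continuous.
apply: mx_continuous => i j.
rewrite (_ : (fun x => _) = (fun p => (Num.sqrt (dotv (dir p) (dir p)))^-1 * dir p i j)).
  move=> p; exact: (cvgM (cs p) (@entry_continuous _ _ _ _ i j dir_continuous p)).
by apply/funext => x; rewrite mxE.
Qed.

Lemma foot_continuous : continuous foot.
Proof.
apply: mx_continuous => i j.
rewrite (_ : (fun x => _) = (fun x => base x i j - dotv (base x) (unit_dir x) * unit_dir x i j)).
  move=> p; exact: (cvgB (@entry_continuous _ _ _ _ i j base_continuous p) (cvgM (@dotv_continuous _ _ _ base_continuous unit_dir_continuous p) (@entry_continuous _ _ _ _ i j unit_dir_continuous p))).
by apply/funext => x; rewrite /foot !mxE.
Qed.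

Definition normal_rep p : line_rep R d :=
  @exist _ _ (foot p, unit_dir p) (mem_set (unit_dir_neq0 p)).

Lemma normal_rep_same_line p : same_line p (normal_rep p).
Proof. apply/asboolP; exact: foot_unit_dir. Qed.

(* The quotient topology on oriented lines is the one read off the normalized
   representative: unit direction v and the point a with a . v = 0. *)
Lemma oriented_line_continuousP (T : topologicalType) (L : T -> oriented_line R d) :
  continuous L <-> continuous (fun t => foot (repr (L t))) /\
                   continuous (fun t => unit_dir (repr (L t))).
Proof.
split=> [cL|[cf cu]].
  have H (g : line_rep R d -> 'cV[R]_d) : continuous g ->
     (forall p q, same_line p q -> g p = g q) -> continuous (fun t => g (repr (L t))).
    move=> cg sg t; apply: (@continuous_comp _ _ _ L (g \o repr)); first exact: cL.
    apply: repr_comp_continuous => // p q /eqP /eqquotP pq; exact/eqP/sg.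
  by split; apply: H; [exact: foot_continuous|exact: foot_same_line|exact: unit_dir_continuous|exact: unit_dir_same_line].
have -> : L = (fun t => \pi_(oriented_line R d)%qT (normal_rep (repr (L t)))).
  apply/funext => t; rewrite -[LHS]reprK; apply/eqquotP; exact: normal_rep_same_line.
move=> t; apply: (@continuous_comp _ _ _ (fun t => normal_rep (repr (L t))) (\pi_(oriented_line R d)%qT)); last exact: pi_continuous.
by apply: (@continuous_comp_initial (line_rep R d) T _ (fun p : line_rep R d => \val p) (fun t => normal_rep (repr (L t)))) => {}t; exact: (cvg_pair (cf t) (cu t)).
Qed.
End NormalForm.

Section Types.
Variables (R : realType) (n : nat).
Implicit Types (p : 'I_n -> line_rep R n.+1) (l : 'I_n -> oriented_line R n.+1).

Definition height p (i : 'I_n) : R :=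
  \det (row_mx (base (p i)) (\matrix_(k, j) dir (p j) k 0) : 'M[R]_n.+1).

(* The heights depend on the representatives, but only through a common
   positive factor, see height_same_line. *)
Definition line_height l : 'I_n -> R := height (fun i => repr (l i)).

Definition general_position l : Prop := injective (line_height l).

Definition has_type l (s : 'S_n) : Prop :=
  forall i j : 'I_n, (i < j)%N -> line_height l (s i) < line_height l (s j).

Definition universal_of_type (I : set R) (L : R -> oriented_line R n.+1)
    (s : 'S_n) : Prop :=
  forall t : 'I_n -> R, (forall i, I (t i)) ->
    (forall i j : 'I_n, (i < j)%N -> t i < t j) ->
    general_position (L \o t) /\ has_type (L \o t) s.

Lemma height_same_line p q : (forall i, same_line (p i) (q i)) ->
  exists2 c : R, 0 < c & forall i, height q i = c * height p i.
Proof.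
move=> pq; pose A i := row_mx (base (p i)) (\matrix_(k, j) dir (p j) k 0).
have {}pq i : exists ab : R * R, 0 < ab.2 /\
    base (q i) = base (p i) + ab.1 *: dir (p i) /\ dir (q i) = ab.2 *: dir (p i).
  by have /asboolP[a [b H]] := pq i; exists (a, b).
have [ab Hab] := choice pq.
exists (\prod_i (ab i).2) => [|i]; first by apply: prodr_gt0 => i _; case: (Hab i).
pose B := block_mx 1%:M 0 (\col_j (if j == i then (ab i).1 else 0))
            (diag_mx (\row_j (ab j).2)) : 'M[R]_(1 + n).
have -> : height q i = \det ((A i : 'M[R]_(n.+1, 1 + n)) *m B).
  rewrite /height /A /B; congr (\det _).
  rewrite mul_row_block mulmx1 mulmx0 add0r; apply: (f_equal2 (@row_mx R n.+1 1 n)).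
    case: (Hab i) => _ [-> _]; congr (_ + _).
    apply/matrixP => k z; rewrite !ord1 !mxE (bigD1 i)//= big1 ?addr0 => [|j ji].
      by rewrite !mxE eqxx mulrC.
    by rewrite !mxE (negPf ji) mulr0.
  apply/matrixP => k j; rewrite mul_mx_diag !mxE.
  by case: (Hab j) => _ [_ ->]; rewrite !mxE mulrC.
rewrite -[LHS]/(\det ((A i : 'M[R]_(1 + n)) *m B)) det_mulmx mulrC; congr (_ * _).
rewrite det_lblock det1 mul1r det_diag.
by apply: eq_bigr => j _; rewrite mxE.
Qed.

End Types.

(* Main.v *)
(* Write the line at [t] as [a t + R v t] and fix [n = d - 1 >= 4].  If the type
   is not trivial, the height of some line [j] always lies between those of two
   consecutive lines [i], [i + 1].  Letting the parameter of line [i + 1] tend to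
   that of line [i], at [x], the plane spanned by [v x] and [v x'] has a limit
   direction [P x], and the squeeze forces [a y - a x] into the span of [P x],
   [v y] and the remaining directions.  The directions over an interval cannot
   lie in a hyperplane: otherwise the heights would be ordered by one continuous
   injective, hence monotone, function.  So the remaining directions can be chosen
   generically, and [L y] meets the plane [a x + P x] for every [y] on one side of
   [x] (or is parallel to it).  Applying this to two parameters [x0], [x1], the
   directions of the two planes and [a x1 - a x0] span at most 4 < d dimensions,
   so over some interval [v y] escapes this span and [L y] passes through the
   intersection of the two planes, which is contained in a line.  The position of
   [L y] on this line is continuous and injective in [y], hence monotone, and it
   orders the heights: the type is trivial after all. *)
Require Import Defs.
From mathcomp Require Import all_boot all_order all_algebra all_fingroup.
From mathcomp Require Import all_classical all_reals topology normedtype realfun.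
From mathcomp Require Import zify ring lra.

Import Order.TTheory GRing.Theory Num.Theory.
Import numFieldNormedType.Exports.
Local Open Scope classical_set_scope.
Local Open Scope ring_scope.

(** * Permutations: trivial, or one value lies between two consecutive ones *)

Section Permutations.
Local Set Implicit Arguments.
Local Unset Strict Implicit.
Local Open Scope nat_scope.
Variable n : nat.

(** An increasing self-map [r] of ['I_n] satisfies [i <= r i]; using this for both [s] and [s^-1]
    pins down every value. *)
Lemma perm_increasing (s : 'S_n) :
  (forall i j : 'I_n, i < j -> s i < s j) -> s = 1%g.
Proof.
have le_s (r : 'S_n) : (forall i j : 'I_n, i < j -> r i < r j) ->
    forall i : 'I_n, i <= r i.
  move=> rlt [m]; elim: m => [//|m IH] lt_m.
  exact: leq_ltn_trans (IH (ltnW lt_m)) (rlt (Ordinal (ltnW lt_m)) (Ordinal lt_m) _).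
move=> slt; apply/permP => i; rewrite perm1; apply/val_inj/eqP.
rewrite eqn_leq le_s // andbT -{2}(permK s i) le_s // => {}i j ij.
rewrite ltnNge; apply/negP; rewrite leq_eqVlt => /orP[/eqP/val_inj/perm_inj|/slt].
  by move=> E; rewrite E ltnn in ij.
by rewrite !permKV ltnNge (ltnW ij).
Qed.

Lemma perm_decreasing (s : 'S_n) :
  (forall i j : 'I_n, i < j -> s j < s i) -> s = perm (@rev_ord_inj n).
Proof.
move=> slt; have E : (perm (@rev_ord_inj n) * s)%g = 1%g.
  apply: perm_increasing => i j ij; rewrite !permM !permE; apply: slt => /=.
  by have := ltn_ord j; lia.
apply/permP => i; rewrite permE.
by have := congr1 (fun r : 'S_n => r (rev_ord i)) E; rewrite permM permE rev_ordK perm1.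
Qed.

(* Excluding betweenness excludes peaks and valleys at consecutive places. *)
Lemma no_peak_increasing (r : 'I_n -> nat) (i0 i1 : 'I_n) : injective r ->
  (forall i i' j : 'I_n, i' = i.+1 :> nat ->
     ~ (r i < r j < r i' \/ r i' < r j < r i)) ->
  i0 = 0 :> nat -> i1 = 1 :> nat -> r i0 < r i1 ->
  forall i j : 'I_n, i < j -> r i < r j.
Proof.
move=> rI nb e0 e1 r01.
have step (m : nat) (i j : 'I_n) : i = m :> nat -> j = m.+1 :> nat -> r i < r j.
  elim: m i j => [|m IH] i j Ei Ej.
    by rewrite (_ : i = i0) 1?(_ : j = i1) //; apply/val_inj; rewrite /= ?Ei ?Ej ?e0 ?e1.
  have lm : m < n by have := ltn_ord i; lia.
  have lt1 := IH (Ordinal lm) i erefl Ei.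
  rewrite ltnNge; apply/negP => le2; set k := Ordinal lm in lt1.
  have njk : r j != r k.
    by apply/eqP => /rI /(congr1 val) /= E; move: E; rewrite Ej; lia.
  have nji : r j != r i.
    by apply/eqP => /rI /(congr1 val) /= E; move: E; rewrite Ej Ei; lia.
  have [lt3|le3] := ltnP (r k) (r j).
    by apply: (nb k i j Ei); left; lia.
  by apply: (nb i j k); [lia|right; lia].
move=> i [j]; elim: j => [//|j IH] lj /= ij.
have lt1 := step j (Ordinal (ltnW lj)) (Ordinal lj) erefl erefl.
have [E|lt2] := eqVneq (i : nat) j.
  by rewrite (_ : i = Ordinal (ltnW lj)) //; exact/val_inj.
by apply: ltn_trans lt1; apply: IH => /=; lia.
Qed.

(** Without betweenness the direction of the first step propagates to all later ones. The decreasing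
    case is the increasing one for the reflected values [n - s i]. *)
Lemma perm_between (s : 'S_n) : 1 < n ->
  (s = 1%g \/ s = perm (@rev_ord_inj n)) \/
  exists i i' j : 'I_n, i' = i.+1 :> nat /\
    (s i < s j < s i' \/ s i' < s j < s i).
Proof.
move=> n1; have n0 := ltnW n1.
have [|nb] := pselect (exists i i' j : 'I_n, i' = i.+1 :> nat /\
    (s i < s j < s i' \/ s i' < s j < s i)); first by right.
left; pose o0 := Ordinal n0; pose o1 := Ordinal n1.
have sI : injective (fun i => s i : nat) by move=> i j /val_inj /perm_inj.
have [lt01|le10] := ltnP (s o0) (s o1).
  left; apply: perm_increasing; apply: (@no_peak_increasing _ o0 o1) => // i i' j E H.
  by apply: nb; exists i, i', j.
right; apply: perm_decreasing => i j ij.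
suff : n - s i < n - s j by have := ltn_ord (s i); lia.
apply: (@no_peak_increasing (fun i => n - s i) o0 o1) => //.
- move=> k l E; apply: sI; have := ltn_ord (s k); have := ltn_ord (s l); lia.
- move=> k k' l E H; apply: nb; exists k, k', l; split=> //.
  by have := ltn_ord (s k); have := ltn_ord (s l); have := ltn_ord (s k'); lia.
- have : s o1 != s o0 by rewrite (inj_eq perm_inj).
  by rewrite -val_eqE /=; have := ltn_ord (s o0); have := ltn_ord (s o1); lia.
Qed.

End Permutations.

(** * Increasing parameter sequences through two prescribed values *)

Section Interpolation.
Local Set Implicit Arguments.
Local Unset Strict Implicit.
Variable R : realFieldType.
Implicit Types (p q x y : R) (tau : nat -> R).

Let prepend x tau (k : nat) := if k is k'.+1 then tau k' else x.

(** Terms are prepended to an infinite tail until [x] and [y] reach their indices. Since the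
    sequence is infinite, even the last index [k : 'I_n] has a slot from [tau k] to [tau k.+1]. *)
Lemma increasing_interpolation i j p q x y : (i < j)%N -> p < x -> x < y -> y < q ->
  exists tau : nat -> R, [/\ tau i = x, tau j = y,
    forall k, p < tau k < q & forall k, tau k < tau k.+1].
Proof.
have from z q' : z < q' -> exists tau : nat -> R, [/\ tau 0%N = z,
    forall k, z <= tau k < q' & forall k, tau k < tau k.+1].
  (* This tail starts at [z] and increases towards [q'] without reaching it. *)
  move=> zq; exists (fun k => q' - (q' - z) / k.+1%:R).
  have d0 : 0 < q' - z by rewrite subr_gt0.
  split=> [|k|k]; first by rewrite divr1; lra.
    have H : 0 < (q' - z) / k.+1%:R <= q' - z.
      rewrite divr_gt0 ?ltr0n //= ler_pdivrMr ?ltr0n // ler_peMr ?(ltW d0) //.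
      by rewrite ler1n.
    by move: H; set e := _ / _; lra.
  by rewrite ltrD2l ltrN2 ltr_pM2l // ltf_pV2 ?posrE ?ltr0n // ltr_nat.
have fromx q' y' j' x' : x' < y' -> y' < q' -> exists tau : nat -> R, [/\ tau 0%N = x',
    tau j'.+1 = y', forall k, x' <= tau k < q' & forall k, tau k < tau k.+1].
  move=> + yq; elim: j' x' => [|j' IH] x' xy.
    have [tau [t0 tb tS]] := from _ _ yq.
    exists (prepend x' tau); split=> //= -[|k] /=; rewrite ?t0 //.
    - by lra.
    - by have := tb k; lra.
  have [|tau [t0 tj tb tS]] := IH ((x' + y') / 2); first by lra.
  exists (prepend x' tau); split=> //= -[|k] /=; rewrite ?t0 //.
  - by lra.
  - by have := tb k; lra.
  - by lra.
move=> + + + yq; elim: i j p x => [|i IH] [//|j] p x /= ij px xy.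
  have [tau [t0 tj tb tS]] := fromx _ _ j _ xy yq.
  by exists tau; split=> // k; have := tb k; lra.
have [||tau [t0 tj tb tS]] := IH j ((p + x) / 2) x ij; [lra|lra|].
exists (prepend ((p + x) / 2) tau); split=> //= -[|k] /=; rewrite ?t0 //.
- by lra.
- by have := tb k; lra.
- by have := tb 0%N; lra.
Qed.

End Interpolation.

Lemma increasing_nat (R : realFieldType) (tau : nat -> R) :
  (forall k, tau k < tau k.+1) -> forall k l, (k < l)%N -> tau k < tau l.
Proof.
move=> H k; elim=> [//|l IH]; rewrite ltnS leq_eqVlt => /orP[/eqP-> //|/IH lt].
exact: lt_trans lt (H l).
Qed.

(** * Heights as determinants of rows *)

Definition upd {n : nat} {T : Type} (f : 'I_n -> T) (k : 'I_n) (z : T) (l : 'I_n) : T :=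
  if l == k then z else f l.

(** The height determinant in transposed form: with vectors as rows, spans and ranks are those of
    row spaces. *)
Definition hdet {R : comNzRingType} {n : nat} (b : 'rV[R]_n.+1)
    (w : 'I_n -> 'rV[R]_n.+1) : R :=
  \det (col_mx b (\matrix_(k < n) w k) : 'M[R]_n.+1).

Section HeightDeterminant.
Local Set Implicit Arguments.
Local Unset Strict Implicit.
Variables (R : comNzRingType) (n : nat).
Implicit Types (b c d : 'rV[R]_n.+1) (w : 'I_n -> 'rV[R]_n.+1).

Let rows b w (i : 'I_n.+1) := oapp w b (unlift ord0 i).

Let hdetE b w : hdet b w = \det (\matrix_(i < n.+1) rows b w i).
Proof.
congr (\det _); apply/matrixP => i j; rewrite -[i in LHS]/(i : 'I_(1 + n)) mxE.
rewrite [RHS]mxE /rows; case: unliftP => [k|] -> /=.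
  by rewrite (_ : lift ord0 k = rshift 1 k :> 'I_(1 + n)) ?row_mxKr;
     [rewrite (unsplitK (inr k)) mxE|exact/val_inj].
by rewrite (_ : ord0 = lshift n ord0 :> 'I_(1 + n)) ?(unsplitK (inl _)) //; exact/val_inj.
Qed.

Let multilin (B C D : 'I_n.+1 -> 'rV[R]_n.+1) i0 (x y : R) :
  B i0 = x *: C i0 + y *: D i0 -> (forall i, i0 != i -> C i = B i /\ D i = B i) ->
  \det (\matrix_i B i) = x * \det (\matrix_i C i) + y * \det (\matrix_i D i).
Proof.
move=> E0 E; apply: (determinant_multilinear (i0 := i0)); rewrite ?rowK //.
  by apply/row_matrixP => i; rewrite !row_rowsub !rowK; case: (E _ (neq_lift i0 i)).
by apply/row_matrixP => i; rewrite !row_rowsub !rowK; case: (E _ (neq_lift i0 i)).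
Qed.

Lemma hdet_linear x y b c w : hdet (x *: b + y *: c) w = x * hdet b w + y * hdet c w.
Proof.
rewrite !hdetE; apply: (@multilin _ _ _ ord0); rewrite /rows ?unlift_none //.
by move=> i; case: unliftP => [k|] -> //; rewrite eqxx.
Qed.

Lemma hdetB b c w : hdet (b - c) w = hdet b w - hdet c w.
Proof. by have := hdet_linear 1 (-1) b c w; rewrite scale1r scaleN1r mul1r mulN1r. Qed.

Lemma hdetZ x b w : hdet (x *: b) w = x * hdet b w.
Proof. by have := hdet_linear x 0 b 0 w; rewrite scale0r mul0r !addr0. Qed.

Lemma hdet_upd_linear x y b w k c d : hdet b (upd w k (x *: c + y *: d)) =
  x * hdet b (upd w k c) + y * hdet b (upd w k d).
Proof.
rewrite !hdetE; apply: (@multilin _ _ _ (lift ord0 k)); rewrite /rows ?liftK /=.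
  by rewrite /upd eqxx.
move=> i; case: unliftP => [l|] -> //= lk; rewrite /upd.
by rewrite (inj_eq lift_inj) eq_sym in lk; rewrite (negPf lk).
Qed.

Lemma hdet_alternate b w k l : k != l -> w k = w l -> hdet b w = 0.
Proof.
move=> kl E; rewrite hdetE.
rewrite (determinant_alternate (i1 := lift ord0 k) (i2 := lift ord0 l)) ?(inj_eq lift_inj) //.
by move=> i; rewrite !mxE /rows !liftK /= E.
Qed.

Lemma hdet_row w k : hdet (w k) w = 0.
Proof.
rewrite hdetE (determinant_alternate (i1 := ord0) (i2 := lift ord0 k)) //.
by move=> i; rewrite !mxE /rows liftK unlift_none.
Qed.

Lemma upd_id (w : 'I_n -> 'rV[R]_n.+1) k : upd w k (w k) = w.
Proof. by apply/funext => l; rewrite /upd; case: eqP => [->|]. Qed.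

(** The term along [w l] produces two equal rows. So a direction matters only modulo the other
    directions, which is what allows passing to a limit plane. *)
Lemma hdet_upd_shift b w k l x c z : k != l ->
  hdet b (upd w k (x *: c + z *: w l)) = x * hdet b (upd w k c).
Proof.
move=> kl; rewrite hdet_upd_linear [X in _ + z * X](@hdet_alternate _ _ k l) ?mulr0 ?addr0 //.
by rewrite /upd eqxx eq_sym (negPf kl).
Qed.

End HeightDeterminant.

Section HeightDeterminantField.
Local Set Implicit Arguments.
Local Unset Strict Implicit.
Variables (F : fieldType) (n : nat).
Implicit Types (b : 'rV[F]_n.+1) (w : 'I_n -> 'rV[F]_n.+1).

(** All rows lie in the hyperplane defined by [c], so the matrix cannot be invertible. *)
Lemma hdet_ker b w (c : 'cV[F]_n.+1) : c != 0 -> b *m c = 0 ->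
  (forall k, w k *m c = 0) -> hdet b w = 0.
Proof.
move=> c0 bc wc; apply/eqP; apply: contraTT c0 => D0; rewrite negbK.
have U : (col_mx b (\matrix_(k < n) w k) : 'M[F]_n.+1) \in unitmx.
  by rewrite unitmxE unitfE.
suff E : (col_mx b (\matrix_(k < n) w k) : 'M[F]_n.+1) *m c = 0.
  by rewrite -(mulKmx U c) E mulmx0.
rewrite -[LHS]/((col_mx b (\matrix_(k < n) w k) : 'M[F]_(1 + n, n.+1)) *m c).
rewrite mul_col_mx bc; apply/eqP; rewrite -[_ == 0]/(_ == 0 :> 'cV_(1 + n)) col_mx_eq0.
rewrite eqxx /=; apply/eqP/row_matrixP => k.
by rewrite row_mul rowK wc row0.
Qed.

Lemma hdet_full b w : (1%:M <= b + \sum_k <<w k>>)%MS -> hdet b w != 0.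
Proof.
move=> full; rewrite /hdet -unitfE -unitmxE -row_full_unit -sub1mx.
apply: submx_trans full (submx_trans _ (_ : b + \matrix_(k < n) w k <= _)%MS).
  rewrite addsmxS //; apply/sumsmx_subP => k _; rewrite genmxE.
  by apply: (eq_row_sub k); rewrite rowK.
by have := submx_refl (col_mx b (\matrix_(k < n) w k)); rewrite -{1}addsmxE.
Qed.

End HeightDeterminantField.

(** * Continuity of determinants in their rows *)

Section Continuity.
Local Set Implicit Arguments.
Local Unset Strict Implicit.
Variable R : realType.

Lemma cvg_det (T : Type) (F : set_system T) (FF : Filter F) m
    (A : T -> 'M[R]_m) (A0 : 'M[R]_m) :
  (forall i j, (fun x => A x i j) @ F --> A0 i j) ->
  (fun x => \det (A x)) @ F --> \det A0.
Proof.
move=> cA; rewrite /determinant.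
apply: cvg_big => [|s _]; first exact: add_continuous.
apply: cvgM; first exact: cvg_cst.
apply: cvg_big => [|k _]; first exact: mul_continuous.
exact: cA.
Qed.

Lemma cvg_coord (T : Type) (F : set_system T) (FF : Filter F) n
    (f : T -> 'rV[R]_n) (f0 : 'rV[R]_n) i j :
  f @ F --> f0 -> (fun x => f x i j) @ F --> f0 i j.
Proof.
move=> cf; apply: (@cvg_comp _ _ _ f (fun M : 'rV[R]_n => M i j) _ _ _ cf).
exact: coord_continuous.
Qed.

Lemma cvg_mulmx_coord (T : Type) (F : set_system T) (FF : Filter F) n m
    (f : T -> 'rV[R]_n) (f0 : 'rV[R]_n) (M : 'M[R]_(n, m)) i j :
  f @ F --> f0 -> (fun x => (f x *m M) i j) @ F --> (f0 *m M) i j.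
Proof.
move=> cf; rewrite mxE; under eq_fun do rewrite mxE.
apply: cvg_big => [|k _]; first exact: add_continuous.
apply: cvgM; [exact: cvg_coord|exact: cvg_cst].
Qed.

Lemma cvg_hdet (T : Type) (F : set_system T) (FF : Filter F) n
    (b : T -> 'rV[R]_n.+1) (b0 : 'rV[R]_n.+1)
    (w : T -> 'I_n -> 'rV[R]_n.+1) (w0 : 'I_n -> 'rV[R]_n.+1) :
  b @ F --> b0 -> (forall k, w^~ k @ F --> w0 k) ->
  (fun x => hdet (b x) (w x)) @ F --> hdet b0 w0.
Proof.
move=> cb cw; apply: cvg_det => i j.
have Eu (y : 'rV[R]_n.+1) (c : 'M[R]_(n, n.+1)) k :
  (col_mx y c : 'M[R]_n.+1) (lshift n k : 'I_(1 + n)) j = y k j by exact: col_mxEu.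
have Ed (y : 'rV[R]_n.+1) (c : 'M[R]_(n, n.+1)) k :
  (col_mx y c : 'M[R]_n.+1) (rshift 1 k : 'I_(1 + n)) j = c k j by exact: col_mxEd.
have [k|k] := split_ordP (i : 'I_(1 + n)) => ->.
  by rewrite Eu; under eq_fun do rewrite Eu; exact: cvg_coord.
by rewrite Ed mxE; under eq_fun do rewrite Ed mxE; exact: cvg_coord.
Qed.

End Continuity.

(** * Ranks of spans of rows *)

Section RankOfRows.
Local Set Implicit Arguments.
Local Unset Strict Implicit.
Variables (F : fieldType) (m : nat).
Implicit Types (W P : 'M[F]_m) (y b : 'rV[F]_m).

Lemma rank_adds_row_le r (A : 'M[F]_(r, m)) y : (\rank (A + y)%MS <= (\rank A).+1)%N.
Proof.
have := rank_leq_row y; have [le _] := mxrank_adds_leqif A y.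
by move: le; lia.
Qed.

Lemma rank_adds_row r (A : 'M[F]_(r, m)) y :
  ~~ (y <= A)%MS -> \rank (A + y)%MS = (\rank A).+1.
Proof.
move=> yA; apply/eqP; rewrite eqn_leq rank_adds_row_le /=.
by apply: rank_ltmx; rewrite /ltmx addsmxSl addsmx_sub submx_refl.
Qed.

(** [P + y] already attains the rank bound, so adding [b] does not enlarge it. This turns a rank
    bound into an incidence of a line with a plane. *)
Lemma sub_adds_of_rank b P y : ~~ (y <= P)%MS ->
  (\rank ((b + P) + y)%MS <= (\rank P).+1)%N -> (b <= P + y)%MS.
Proof.
move=> yP; rewrite -(rank_adds_row yP) => rk.
have S : ((P + y) <= (b + P) + y)%MS by rewrite addsmxS // addsmxSr.
have [_ E] := mxrank_leqif_sup S.
have : ((b + P) + y <= P + y)%MS by rewrite -E eqn_leq rk mxrankS.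
by apply: submx_trans; rewrite -addsmxA addsmxSl.
Qed.

Lemma rank_le1_sub W : (\rank W <= 1)%N -> exists e : 'rV[F]_m, (W <= e)%MS.
Proof.
move=> W1; exists (nz_row W); have [->|W0] := eqVneq W 0; first exact: sub0mx.
have S := nz_row_sub W; have [_ <-] := mxrank_leqif_sup S.
rewrite eqn_leq mxrankS //=; apply: leq_trans W1 _.
by rewrite lt0n mxrank_eq0 nz_row_eq0.
Qed.

End RankOfRows.

Definition increasing {R : realType} {n : nat} (t : 'I_n -> R) : Prop :=
  forall i j : 'I_n, (i < j)%N -> t i < t j.

(** The half-open slots are disjoint and ordered, so parameters may be chosen independently within
    them. *)
Lemma increasing_slots (R : realType) (n : nat) (tau : nat -> R) (t : 'I_n -> R) :
  (forall k, tau k < tau k.+1) -> (forall k : 'I_n, tau k <= t k < tau k.+1) ->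
  increasing t.
Proof.
move=> tauS ht i j ij; have /andP[_ lt1] := ht i; have /andP[le2 _] := ht j.
apply: lt_le_trans lt1 (le_trans _ le2); move: ij; rewrite leq_eqVlt => /orP[/eqP <- //|].
by move=> /(increasing_nat _ _ tauS)/ltW.
Qed.

(** * Universal families given by curves of base points and directions *)

Section UniversalCurves.
Local Set Implicit Arguments.
Local Unset Strict Implicit.
Variables (R : realType) (n : nat) (a v : R -> 'rV[R]_n.+1) (p q : R) (s : 'S_n).
Hypothesis n4 : (4 <= n)%N.
Hypothesis ca : forall x, p < x < q -> {for x, continuous a}.
Hypothesis cv : forall x, p < x < q -> {for x, continuous v}.
Hypothesis univ : forall t : 'I_n -> R, (forall i, p < t i < q) -> increasing t ->
  forall i j : 'I_n, (i < j)%N ->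
  hdet (a (t (s i))) (v \o t) < hdet (a (t (s j))) (v \o t).

Let trivial := s = 1%g \/ s = perm (@rev_ord_inj n).

Let o0 : 'I_n := Ordinal (ltnW (ltnW (ltnW n4))).
Let o1 : 'I_n := Ordinal (ltnW (ltnW n4)).

(** [s^-1 i] is the rank of line [i] in the order of heights. *)
Lemma univ_lt (t : 'I_n -> R) (i j : 'I_n) : (forall i, p < t i < q) -> increasing t ->
  (s^-1%g i < s^-1%g j)%N -> hdet (a (t i)) (v \o t) < hdet (a (t j)) (v \o t).
Proof. by move=> tb ti /(univ tb ti); rewrite !permKV. Qed.

Lemma univ_neq (t : 'I_n -> R) (i j : 'I_n) : (forall i, p < t i < q) -> increasing t ->
  i != j -> hdet (a (t i) - a (t j)) (v \o t) != 0.
Proof.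
move=> tb ti ij; rewrite hdetB subr_eq0.
have : s^-1%g i != s^-1%g j by rewrite (inj_eq perm_inj).
rewrite -val_eqE neq_ltn => /orP[]/(univ_lt tb ti) H; last by rewrite gt_eqF.
by rewrite lt_eqF.
Qed.

Lemma two_slots p' q' x y : p' < x -> x < y -> y < q' -> exists t : 'I_n -> R,
  [/\ t o0 = x, t o1 = y, forall i, p' < t i < q' & increasing t].
Proof.
move=> px xy yq.
have [tau [t0 t1 tb tS]] := increasing_interpolation (ltn0Sn 0) px xy yq.
by exists (fun k => tau k); split=> // i j; exact: increasing_nat.
Qed.

(** With [x] and [y] in the first two slots, each degeneracy would annihilate the difference of
    their heights. Thus any two lines of the family are skew. *)
Lemma univ_indep x y : p < x -> x < y -> y < q ->
  [/\ v x != 0, ~~ (v y <= v x)%MS & ~~ (a x - a y <= v x + v y)%MS].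
Proof.
move=> px xy yq; have [t [t0 t1 tb ti]] := two_slots px xy yq.
have := univ_neq (i := o0) (j := o1) tb ti isT; rewrite t0 t1 => D0; split.
- apply: contra_neq D0 => E.
  have -> : v \o t = upd (v \o t) o0 (0 *: 0 + 0 *: (v \o t) o1).
    by rewrite scaler0 scale0r addr0 -[0]E -t0 -[v (t o0)]/((v \o t) o0) upd_id.
  by rewrite hdet_upd_shift ?mul0r.
- apply: contra_neqN D0 => /sub_rVP[c E].
  have -> : v \o t = upd (v \o t) o1 (0 *: 0 + c *: (v \o t) o0).
    by rewrite scaler0 add0r /= t0 -E -t1 -[v (t o1)]/((v \o t) o1) upd_id.
  by rewrite hdet_upd_shift ?mul0r.
apply: contra_neqN D0 => /sub_addsmxP[[c d] /=].
rewrite [c]mx11_scalar [d]mx11_scalar !mul_scalar_mx => ->.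
rewrite hdet_linear -t0 -t1 -[v (t o0)]/((v \o t) o0) -[v (t o1)]/((v \o t) o1).
by rewrite !hdet_row !mulr0 addr0.
Qed.

(** Distinct heights make [c] injective, hence monotone by continuity. For a single tuple [t] the
    sign of [E t] then says whether the heights follow or reverse the order of the parameters, and
    this determines [s]. *)
Lemma coordinate_trivial p' q' (c : R -> R) (E : ('I_n -> R) -> R) :
  p <= p' -> p' < q' -> q' <= q ->
  (forall x, p' < x < q' -> {for x, continuous c}) ->
  (forall t, (forall i, p' < t i < q') -> increasing t -> forall i j,
    hdet (a (t i) - a (t j)) (v \o t) = (c (t i) - c (t j)) * E t) -> trivial.
Proof.
move=> pp pq qq cc cE.
have bd (t : 'I_n -> R) : (forall i, p' < t i < q') -> forall i, p < t i < q.
  by move=> tb i; have := tb i; lra.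
have cne x y : p' < x -> x < y -> y < q' -> c x != c y.
  move=> px xy yq; have [t [t0 t1 tb ti]] := two_slots px xy yq.
  have := univ_neq (i := o0) (j := o1) (bd _ tb) ti isT.
  by rewrite cE // t0 t1 mulf_eq0 negb_or subr_eq0 => /andP[].
have cI : {in `]p', q'[ &, injective c}.
  move=> x y; rewrite !in_itv /= => /andP[px xq] /andP[py yq] /eqP E1; apply/eqP.
  apply: contraTT E1 => xy; have [lt|lt|/eqP] := ltgtP x y; last by rewrite (negPf xy).
    exact: cne.
  by rewrite eq_sym; exact: cne.
have ccont : {within [set` `]p', q'[], continuous c}.
  by apply: continuous_in_subspaceT => x; rewrite inE /= in_itv /=; exact: cc.
have [t [_ _ tb ti]] : exists t : 'I_n -> R, [/\ t o0 = (p' + (p' + q') / 2) / 2,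
    t o1 = (p' + q') / 2, forall i, p' < t i < q' & increasing t].
  by apply: two_slots; lra.
have tin i : t i \in `]p', q'[ by rewrite in_itv /= tb.
have key (i j : 'I_n) : (i < j)%N -> (c (t (s i)) - c (t (s j))) * E t < 0.
  by move=> ij; rewrite -cE // hdetB subr_lt0; exact: (univ (bd _ tb) ti).
have sne (i j : 'I_n) : (i < j)%N -> (s i < s j)%N || (s j < s i)%N.
  move=> ij; rewrite -neq_ltn val_eqE (inj_eq perm_inj); apply/eqP => E1.
  by rewrite E1 ltnn in ij.
have E0 : E t != 0.
  by have := key o0 o1 isT; apply: contraTneq => ->; rewrite mulr0 ltxx.
have [cm|cm] := itv_continuous_inj_mono ccont cI; have [Elt|Egt|/eqP] := ltgtP (E t) 0;
  rewrite ?(negPf E0) //.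
- right; apply: perm_decreasing => i j ij; have := key i j ij.
  rewrite nmulr_llt0 // subr_gt0; have /orP[lt|//] := sne i j ij.
  by rewrite lt_gtF // cm // ti.
- left; apply: perm_increasing => i j ij; have := key i j ij.
  rewrite pmulr_llt0 // subr_lt0; have /orP[//|lt] := sne i j ij.
  by rewrite lt_gtF // cm // ti.
- left; apply: perm_increasing => i j ij; have := key i j ij.
  rewrite nmulr_llt0 // subr_gt0; have /orP[//|lt] := sne i j ij.
  by rewrite lt_gtF // cm // ti.
- right; apply: perm_decreasing => i j ij; have := key i j ij.
  rewrite pmulr_llt0 // subr_lt0; have /orP[lt|//] := sne i j ij.
  by rewrite lt_gtF // cm // ti.
Qed.

Lemma hyperplane_trivial p' q' (W : 'M[R]_n.+1) :
  p <= p' -> p' < q' -> q' <= q -> (\rank W < n.+1)%N ->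
  (forall z, p' < z < q' -> (v z <= W)%MS) -> trivial.
Proof.
move=> pp pq qq rW vW.
have [f f0 Wf] : exists2 f : 'cV[R]_n.+1, f != 0 & W *m f = 0.
  have K0 : cokermx W != 0 by rewrite -mxrank_eq0 mxrank_coker -lt0n subn_gt0.
  have /existsP[l Kl] : [exists l, col l (cokermx W) != 0].
    apply: contraNT K0; rewrite negb_exists => /forallP H.
    apply/eqP/matrixP => i l; have := H l; rewrite negbK => /eqP/colP/(_ i).
    by rewrite !mxE.
  by exists (col l (cokermx W)) => //; rewrite colE mulmxA mulmx_coker mul0mx.
have vf z : p' < z < q' -> v z *m f = 0.
  by move=> /vW /submxP[y ->]; rewrite -mulmxA Wf mulmx0.
have [b0 b0f] : exists b0 : 'rV[R]_n.+1, b0 *m f = 1%:M.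
  have /cV0Pn[k fk] := f0.
  exists ((f k 0)^-1 *: delta_mx 0 k); rewrite -scalemxAl -rowE.
  by apply/matrixP => i j; rewrite !ord1 !mxE mulVf.
(* Modulo the kernel of [f], which contains all directions, [a x - a y] is the difference of the
   values of [f] times [b0]. *)
apply: (@coordinate_trivial p' q' (fun z => (a z *m f) 0 0) (fun t => hdet b0 (v \o t))) => //.
  by move=> x xb; apply: cvg_mulmx_coord; apply: ca; lra.
move=> t tb ti i j; rewrite -hdetZ; apply/eqP; rewrite -subr_eq0 -hdetB; apply/eqP.
apply: (hdet_ker f0) => [|k]; last exact: vf.
rewrite mulmxBl -scalemxAl b0f scalemx1 mulmxBl.
by apply/matrixP => k l; rewrite !ord1 !mxE eqxx mulr1n subrr.
Qed.

(** The coordinate is the position [d y] at which the line at [y] meets [b + R e]. It is chosen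
    pointwise; its continuity comes from writing it as a quotient of determinants in which all
    directions but [v y] are frozen. *)
Lemma common_secant_trivial p' q' (b e : 'rV[R]_n.+1) :
  p <= p' -> p' < q' -> q' <= q ->
  (forall y, p' < y < q' -> exists c d : R, a y = b + d *: e + c *: v y) -> trivial.
Proof.
move=> pp pq qq ae.
have [z [_ z1 zb zi]] : exists t : 'I_n -> R, [/\ t o0 = (p' + (p' + q') / 2) / 2,
    t o1 = (p' + q') / 2, forall i, p' < t i < q' & increasing t].
  by apply: two_slots; lra.
have [d dE] : exists d : R -> R, forall y, p' < y < q' ->
    exists c : R, a y = b + d y *: e + c *: v y.
  suff : forall y, exists d : R, p' < y < q' -> exists c : R, a y = b + d *: e + c *: v y.
    by move=> /choice[d dE]; exists d.
  move=> y; have [yb|] := boolP (p' < y < q'); last by exists 0.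
  by have [c [d E]] := ae y yb; exists d => _; exists c.
have hd (t : 'I_n -> R) i : (forall i, p' < t i < q') ->
    hdet (a (t i) - b) (v \o t) = d (t i) * hdet e (v \o t).
  move=> tb; have [c ->] := dE _ (tb i).
  have -> (y y' : 'rV[R]_n.+1) : b + y + y' - b = y + y'.
    by rewrite addrAC [b + y]addrC addrK.
  by rewrite hdet_linear -[v (t i)]/((v \o t) i) hdet_row mulr0 addr0.
have hd2 (t : 'I_n -> R) i j : (forall i, p' < t i < q') ->
    hdet (a (t i) - a (t j)) (v \o t) = (d (t i) - d (t j)) * hdet e (v \o t).
  move=> tb; rewrite mulrBl -!hd // -hdetB; congr (hdet _ _).
  by rewrite opprB addrA addrNK.
have den0 (t : 'I_n -> R) : (forall i, p' < t i < q') -> increasing t ->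
    hdet e (v \o t) != 0.
  move=> tb ti; have tb' i : p < t i < q by have := tb i; lra.
  by have := univ_neq (i := o0) (j := o1) tb' ti isT; rewrite hd2 // mulf_eq0 => /norP[].
have zo1 : p' < z o1 by have := zb o1; lra.
have Tb y : p' < y < z o1 -> forall i, p' < upd z o0 y i < q'.
  by move=> yb i; rewrite /upd; case: eqP => // _; have := zb o1; lra.
have Ti y : p' < y < z o1 -> increasing (upd z o0 y).
  move=> /andP[_ yz] i j ij; rewrite /upd.
  have -> : j == o0 = false by apply/negP => /eqP E; rewrite E in ij.
  case: eqP => [_|_]; last exact: zi.
  apply: lt_le_trans yz _; have [->//|nj] := eqVneq j o1.
  apply/ltW/zi; rewrite ltn_neqAle eq_sym val_eqE nj /=.
  exact: leq_ltn_trans (leq0n _) ij.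
have vT y : v \o upd z o0 y = upd (v \o z) o0 (v y).
  by apply/funext => k; rewrite /= /upd; case: eqP.
(* Below [z o1], the parameter [y] can take the first slot of [z] while the tuple stays increasing,
   so the denominator is nonzero. *)
apply: (@coordinate_trivial p' (z o1)
  (fun y => hdet (a y - b) (upd (v \o z) o0 (v y)) / hdet e (upd (v \o z) o0 (v y)))
  (fun t => hdet e (v \o t))) => //.
- by have := zb o1; lra.
- move=> x xb; have xb' : p < x < q by have := zb o1; lra.
  have cw k : (fun y => upd (v \o z) o0 (v y) k) @ x --> upd (v \o z) o0 (v x) k.
    by rewrite /upd; case: eqP => _; [exact: cv|exact: cvg_cst].
  apply: cvgM; first by apply: cvg_hdet => //; apply: cvgB; [exact: ca|exact: cvg_cst].
  apply: cvgV; first by rewrite -vT; apply: den0; [exact: Tb|exact: Ti].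
  by apply: cvg_hdet => //; exact: cvg_cst.
move=> t tb ti i j; have tb' k : p' < t k < q' by have := tb k; have := zb o1; lra.
have cd k : d (t k) =
    hdet (a (t k) - b) (upd (v \o z) o0 (v (t k))) / hdet e (upd (v \o z) o0 (v (t k))).
  have := hd _ o0 (Tb _ (tb k)); have := den0 _ (Tb _ (tb k)) (Ti _ (tb k)).
  by rewrite vT [upd z o0 (t k) o0]/upd eqxx => D0 ->; rewrite mulfK.
by rewrite hd2 // !cd.
Qed.

(** * Limit planes forced by betweenness *)

Section LimitPlane.
Variables i i' j : 'I_n.
Hypothesis ii' : i' = i.+1 :> nat.
Hypothesis between : (s^-1%g i < s^-1%g j < s^-1%g i')%N \/
                     (s^-1%g i' < s^-1%g j < s^-1%g i)%N.

(** The product form treats both orders of the squeeze at once. *)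
Lemma between_gt0 (t : 'I_n -> R) : (forall i, p < t i < q) -> increasing t ->
  0 < (hdet (a (t j)) (v \o t) - hdet (a (t i)) (v \o t)) *
      (hdet (a (t i')) (v \o t) - hdet (a (t j)) (v \o t)).
Proof.
move=> tb ti; case: between => /andP[/(univ_lt tb ti) H1 /(univ_lt tb ti) H2].
  by rewrite mulr_gt0 // subr_gt0.
by rewrite -mulrNN mulr_gt0 // oppr_gt0 subr_lt0.
Qed.

Let ni : i != i'. Proof. by rewrite -val_eqE /= ii'; lia. Qed.
Let nj : j != i.
Proof. by apply/eqP => E; move: between; rewrite E; case; lia. Qed.
Let nj' : j != i'.
Proof. by apply/eqP => E; move: between; rewrite E; case; lia. Qed.

(* [u] is a cluster point, as [x'] tends to [x] from the right, of the direction
   of [v x'] modulo [v x]; so [v x] and [u] span a limit of the planes spanned by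
   [v x] and [v x'].  The heights of the lines at [x] and [x'] squeeze that of
   the line at [t j]. *)
Lemma limit_plane x : p < x < q -> exists2 u : 'rV[R]_n.+1, ~~ (u <= v x)%MS &
  forall (t : 'I_n -> R) xi, x < xi -> t i = x ->
    (forall x', x < x' < xi -> (forall k, p < upd t i' x' k < q) /\ increasing (upd t i' x')) ->
    hdet (a (t j) - a x) (upd (v \o t) i' u) = 0.
Proof.
move=> xb; have /andP[px xq] := xb.
have vx0 : v x != 0.
  by have [||//] := @univ_indep x ((x + q) / 2) px; lra.
have /rV0Pn[k vxk] := vx0.
(* Subtracting [lam x' *: v x] kills coordinate [k] of [v x']. Unit vectors with zero coordinate [k]
   form a compact set that misses the span of [v x], because [v x 0 k] is nonzero. *)
pose lam x' := v x' 0 k / v x 0 k.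
pose r x' : 'rV[R]_n.+1 := v x' - lam x' *: v x.
pose U x' : 'rV[R]_n.+1 := `|r x'|^-1 *: r x'.
have r0 x' : x < x' < q -> r x' != 0.
  move=> /andP[xx xq']; have [_ + _] := univ_indep px xx xq'.
  by apply: contraNneq => /eqP; rewrite subr_eq0 => /eqP ->; exact: scalemx_sub.
pose A : set 'rV[R]_n.+1 := [set y : 'rV[R]_n.+1 | y 0 k = 0 /\ `|y| = 1].
have UA x' : x < x' < q -> A (U x').
  move=> /r0 rn; split; last by rewrite normrZ normfV normr_id mulVf // normr_eq0.
  by rewrite !mxE /lam divfK // subrr mulr0.
have cptA : compact A.
  apply: bounded_closed_compact.
    exists 1; split=> // M M1 y [_ E]; by rewrite /= E; exact: ltW.
  have cl1 : closed [set y : 'rV[R]_n.+1 | y 0 k = 0].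
    apply: (@closed_comp _ _ (fun y : 'rV[R]_n.+1 => y 0 k) [set 0]); last exact: closed_eq.
    by move=> y _; exact: coord_continuous.
  have cl2 : closed [set y : 'rV[R]_n.+1 | `|y| = 1].
    apply: (@closed_comp _ _ (fun y : 'rV[R]_n.+1 => `|y|) [set 1]); last exact: closed_eq.
    by move=> y _; exact: norm_continuous.
  exact: closedI cl1 cl2.
have [|u [[uk u1] clu]] := cptA (U @ x^'+) _ _.
  suff : \forall x' \near x^'+, A (U x') by [].
  near=> x'; apply: UA; apply/andP; split; near: x'; first exact: nbhs_right_gt.
  exact: nbhs_right_lt.
exists u.
  apply/negP => /sub_rVP[c E]; move: uk u1; rewrite E mxE => /eqP.
  rewrite mulf_eq0 (negPf vxk) orbF => /eqP ->; rewrite scale0r normr0.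
  by move/esym/eqP; rewrite oner_eq0.
move=> t xi xxi tx H; apply/eqP; apply/negPn/negP => e0.
(* The product of the two height gaps after normalizing the moving direction. The squeeze makes it
   positive at [(x', U x')], while at [(x, u)] it is minus a square; by continuity, clustering at
   [u] forces that square to vanish. *)
pose G (z : R * 'rV[R]_n.+1) := hdet (a (t j) - a x) (upd (v \o t) i' z.2) *
                          hdet (a z.1 - a (t j)) (upd (v \o t) i' z.2).
have Gpos x' : x < x' < xi -> 0 < G (x', U x').
  move=> xx; have [tb ti] := H x' xx.
  have xx2 : x < x' < q by have := tb i'; rewrite /upd eqxx; lra.
  have := between_gt0 tb ti; rewrite -!hdetB /=.
  have -> : v \o upd t i' x' = upd (v \o t) i' (v x').
    by apply/funext => l; rewrite /= /upd; case: eqP.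
  have -> : upd t i' x' i = x by rewrite /upd (negPf ni).
  have -> : upd t i' x' j = t j by rewrite /upd (negPf nj').
  have -> : upd t i' x' i' = x' by rewrite /upd eqxx.
  have rn := r0 _ xx2.
  have -> : v x' = `|r x'| *: U x' + lam x' *: (v \o t) i.
    by rewrite /U scalerA divff ?normr_eq0 // scale1r /= tx subrK.
  rewrite !hdet_upd_shift 1?eq_sym // mulrACA pmulr_rgt0 //.
  by rewrite mulr_gt0 // normr_gt0.
have Gcvg : G z @[z --> (x, u)] --> G (x, u).
  have cw l : (fun z : R * 'rV[R]_n.+1 => upd (v \o t) i' z.2 l) @ (x, u) -->
      upd (v \o t) i' u l.
    by rewrite /upd; case: eqP => _; [exact: cvg_snd|exact: cvg_cst].
  apply: cvgM; apply: cvg_hdet => //; first exact: cvg_cst.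
  apply: cvgB; last exact: cvg_cst.
  by apply: (@cvg_comp _ _ _ fst a); [exact: cvg_fst|exact: ca].
have Gneg : G (x, u) < 0.
  rewrite /G /= (_ : a x - a (t j) = -1 *: (a (t j) - a x)); last by rewrite scaleN1r opprB.
  rewrite hdetZ mulN1r mulrN oppr_lt0.
  by rewrite -expr2 lt0r sqrf_eq0 e0 sqr_ge0.
have [[B C] /= [Bx Cu] BC] : nbhs (x, u) [set z | G z < 0].
  exact: (cvgr_lt _ Gcvg).
have /(_ (U @` (B `&` [set x' | x < x' < xi])) C) [] := clu => //.
  have : x^'+ (B `&` [set x' | x < x' < xi]).
    near=> x'; split; last (apply/andP; split).
    - near: x'; exact: cvg_within.
    - near: x'; exact: nbhs_right_gt.
    - near: x'; exact: nbhs_right_lt.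
  by apply: filterS => x' Hx'; exists x'.
move=> y [[x' [Bx' xx'] <-] Cy]; have /= := BC (x', U x') (conj Bx' Cy).
by rewrite ltNge (ltW (Gpos _ xx')).
Unshelve. all: by end_near.
Qed.
Hypothesis nontrivial : ~ trivial.

Lemma escape (W : 'M[R]_n.+1) p' q' : p <= p' -> p' < q' -> q' <= q ->
  (\rank W < n.+1)%N -> exists2 z, p' < z < q' & ~~ (v z <= W)%MS.
Proof.
move=> pp pq qq rW; apply: contrapT => H; apply: nontrivial.
apply: (hyperplane_trivial pp pq qq rW) => z zb.
by apply/negPn/negP => vz; apply: H; exists z.
Qed.

(** A greedy choice: before each step the span is still proper, and [escape] finds a direction
    outside it within the window of the next index. *)
Lemma generic_extension (W : 'M[R]_n.+1) (r : seq 'I_n) (lo hi : 'I_n -> R) :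
  uniq r -> (forall k, [/\ p <= lo k, lo k < hi k & hi k <= q]) ->
  (\rank W + size r <= n.+1)%N ->
  exists2 t : 'I_n -> R, forall k, lo k < t k < hi k &
    \rank (W + \sum_(k <- r) <<v (t k)>>)%MS = (\rank W + size r)%N.
Proof.
move=> + lohi; elim: r => [_ _|k r IH /= /andP[kr ur]].
  exists (fun k => (lo k + hi k) / 2) => [k|]; first by have [] := lohi k; lra.
  by rewrite big_nil addsmx0 addn0.
rewrite addnS => lt; have [t tb rt] := IH ur (ltnW lt).
have [le1 lt1 le2] := lohi k.
have [|z zb vz] := @escape (W + \sum_(l <- r) <<v (t l)>>)%MS _ _ le1 lt1 le2.
  by rewrite rt.
exists (upd t k z) => [l|]; first by rewrite /upd; case: eqP => [->|].
rewrite -rt -(rank_adds_row vz) big_cons; apply/eqmx_rank/eqmxP.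
have -> : (\sum_(l <- r) <<v (upd t k z l)>> = \sum_(l <- r) <<v (t l)>>)%MS.
  apply: eq_big_seq => l lr; rewrite /upd; case: eqP => // E.
  by rewrite -E lr in kr.
rewrite [upd _ _ _ _]/upd eqxx [(<<v z>> + _)%MS]addsmxC addsmxA.
exact: adds_eqmx (eqmx_refl _) (genmxE _).
Qed.

(** The determinant of [limit_plane] vanishes for every admissible filling of the other slots, so a
    generic filling leaves the dependency to these four vectors. Rank at most 3 means that the line
    at [y] meets the plane through [a x] spanned by [v x] and [u], or is parallel to it. The side
    condition lets [x] and [y] occupy slots [i] and [j]. *)
Lemma limit_plane_dep x : p < x < q -> exists2 u : 'rV[R]_n.+1, ~~ (u <= v x)%MS &
  forall y, p < y < q -> (if (i < j)%N then x < y else y < x) ->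
  (\rank (((a y - a x)%R + (v x + u)) + v y)%MS <= 3)%N.
Proof.
move=> xb; have [u uv H] := limit_plane xb; exists u => // y yb side.
have [tau [taui tauj taub tauS]] : exists tau : nat -> R,
    [/\ tau i = x, tau j = y, forall k, p < tau k < q & forall k, tau k < tau k.+1].
  move: side; case: ltnP => ij xy.
    by apply: increasing_interpolation => //; lra.
  have ji : (j < i)%N by rewrite ltn_neqAle val_eqE nj.
  have [||tau [t1 t2 t3 t4]] := increasing_interpolation ji _ xy _ (p := p) (q := q); try lra.
  by exists tau.
set W := (_ + v y)%MS; rewrite leqNgt; apply/negP => rW.
(* Slots [i], [i'], [j] carry [v x], [u], [v y]. If [W] had rank 4, generic directions in the
   remaining [n - 3] slots would complete it to rank [n + 1]. *)
pose r := [seq k <- enum 'I_n | k \notin [:: i; i'; j]].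
have ur : uniq r by rewrite filter_uniq // enum_uniq.
have sz : size r = (n - 3)%N.
  have := count_predC (mem [:: i; i'; j]) (enum 'I_n).
  rewrite size_enum_ord => E.
  have : count (mem [:: i; i'; j]) (enum 'I_n) = 3%N.
    rewrite -size_filter; apply/eqP; rewrite -[3%N]/(size [:: i; i'; j]).
    apply/eqP/perm_size/uniq_perm.
    - by rewrite filter_uniq // enum_uniq.
    - by rewrite /= !inE negb_or ni eq_sym nj eq_sym nj'.
    by move=> k; rewrite mem_filter mem_enum andbT.
  rewrite /r size_filter; move: E; set c1 := count _ _; set c2 := count _ _.
  by move=> E E3; rewrite -E E3 addKn.
have rW4 : (\rank W <= 4)%N.
  apply: leq_trans (rank_adds_row_le _ _) _; rewrite ltnS.
  apply: leq_trans (_ : \rank ((v x + u) + (a y - a x)%R)%MS <= 3)%N.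
    by rewrite addsmxC.
  apply: leq_trans (rank_adds_row_le _ _) _; rewrite ltnS.
  by apply: leq_trans (rank_adds_row_le _ _) _; rewrite ltnS rank_leq_row.
have [||t0 t0b rt0] := @generic_extension W r (fun k => tau k) (fun k => tau k.+1) ur.
- by move=> k; split=> //; [have := taub k|have := taub k.+1]; lra.
- by rewrite sz; lia.
pose t (k : 'I_n) := if k == i then x else if k == j then y else t0 k.
have tslot (k : 'I_n) : tau k <= t k < tau k.+1.
  rewrite /t; case: eqP => [->|_]; first by rewrite taui lexx /= -taui.
  case: eqP => [->|_]; first by rewrite tauj lexx /= -tauj.
  by have := t0b k; lra.
have xlt : x < tau i.+1 by rewrite -taui.
have ti : t i = x by rewrite /t eqxx.
have tj : t j = y by rewrite /t (negPf nj) eqxx.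
suff full : hdet (a (t j) - a x) (upd (v \o t) i' u) != 0.
  move: full; rewrite (H t _ xlt ti) ?eqxx // => x' xx'.
  (* Slot [i'] is extended leftwards to start at [x'], which lies after [x] and before [tau i']; the
     slots stay ordered. *)
  pose tau' (k : nat) := if k == i' :> nat then x' else tau k.
  have ltau : x' < tau i' by rewrite ii'; case/andP: xx'.
  have tauS' k : tau' k < tau' k.+1.
    rewrite /tau'; case: eqP => [->|_]; first by rewrite gtn_eqF //; have := tauS i'; lra.
    case: eqP => [E|//]; have -> : k = i by move: E; rewrite ii' => -[].
    by rewrite taui; case/andP: xx'.
  have slot (k : 'I_n) : tau' k <= upd t i' x' k < tau' k.+1.
    have := tauS' k; rewrite /tau' /upd -[k == i']val_eqE /=; case: eqP => [-> ->|nk].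
      by rewrite lexx.
    have := tslot k; case: eqP => [E|//]; have -> : k = i.
      by apply/val_inj; move: E; rewrite ii' => -[].
    by rewrite ti taui; lra.
  split; last exact: increasing_slots slot.
  have tau'b k : p < tau' k < q.
    rewrite /tau'; case: eqP => _ //.
    by have := taub i'; case/andP: xx'; lra.
  by move=> k; have := slot k; have := tau'b k; have := tau'b k.+1; lra.
apply: hdet_full; rewrite tj.
have full : (1%:M <= W + \sum_(k <- r) <<v (t0 k)>>)%MS.
  by rewrite sub1mx /row_full rt0 sz; apply/eqP; lia.
apply: submx_trans full _; set w := upd (v \o t) i' u.
have sub k : (w k <= (a y - a x)%R + \sum_l <<w l>>)%MS.
  apply: submx_trans (addsmxSr _ _); apply: submx_trans (sumsmx_sup k _ _) => //.
  by rewrite genmxE.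
have wi : w i = v x by rewrite /w /upd (negPf ni) /= /t eqxx.
have wi' : w i' = u by rewrite /w /upd eqxx.
have wj : w j = v y by rewrite /w /upd (negPf nj') /= tj.
rewrite addsmx_sub; apply/andP; split.
  rewrite !addsmx_sub addsmxSl /=.
  by apply/andP; split; [rewrite -wi -{1}wi' !sub|rewrite -wj sub].
rewrite big_seq_cond; elim/big_ind: _ => [|B C B1 C1|k]; first exact: sub0mx.
  by rewrite addsmx_sub B1.
rewrite andbT mem_filter !inE !negb_or => /andP[/and3P[k1 k2 k3] _]; rewrite genmxE.
have <- : w k = v (t0 k); last exact: sub.
by rewrite /w /upd (negPf k2) /= /t (negPf k1) (negPf k3).
Qed.

Lemma no_betweenness : p < q -> False.
Proof.
move=> pq.
(* Cutting []p, q[] into fifths, [x0], [x1] and an interval follow one another in the direction from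
   slot [i] to slot [j]. So [limit_plane_dep] at [x0] applies to [x1], and at both points to every
   [y] of the interval. *)
have [x0 [x1 [p' [q' [x0b x1b [pp pq' qq] H]]]]] : exists x0 x1 p' q' : R,
    [/\ p < x0 < q, p < x1 < q, [/\ p <= p', p' < q' & q' <= q] &
     [/\ x0 != x1, (if (i < j)%N then x0 < x1 else x1 < x0) & forall y, p' < y < q' ->
      (if (i < j)%N then x0 < y else y < x0) /\ (if (i < j)%N then x1 < y else y < x1)]].
  pose e := (q - p) / 5; have e0 : 0 < e by rewrite /e; lra.
  have eq5 : q = p + 5 * e by rewrite /e; lra.
  clearbody e; case: (i < j)%N.
    exists (p + e), (p + 2 * e), (p + 3 * e), (p + 4 * e); rewrite eq5.
    split; [lra|lra|split; lra|split; [lra|lra|]].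
    by move=> y yb; split; lra.
  exists (p + 4 * e), (p + 3 * e), (p + e), (p + 2 * e); rewrite eq5.
  split; [lra|lra|split; lra|split; [lra|lra|]].
  by move=> y yb; split; lra.
case: H => x01 s01 sy; have /andP[px0 x0q] := x0b; have /andP[px1 x1q] := x1b.
have [u0 u0v dep0] := limit_plane_dep x0b; have [u1 u1v dep1] := limit_plane_dep x1b.
set P0 := (v x0 + u0)%MS in dep0; set P1 := (v x1 + u1)%MS in dep1.
have vn0 x : p < x < q -> v x != 0.
  by move=> xb; have [|||//] := @univ_indep x ((x + q) / 2); lra.
have rP0 : \rank P0 = 2 by rewrite rank_adds_row // rank_rV vn0.
have rP1 : \rank P1 = 2 by rewrite rank_adds_row // rank_rV vn0.
(* All summands but [u1] have joint rank at most 3, by [dep0] at [x1]. So [S] has rank at most 4 and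
   is proper because [n >= 4]. *)
pose S := ((((a x1 - a x0)%R + P0) + v x1) + u1)%MS.
have rS : (\rank S < n.+1)%N.
  apply: leq_ltn_trans (rank_adds_row_le _ _) _.
  by apply: leq_trans (_ : 4 < n.+1)%N => //; rewrite ltnS ltnS dep0.
have SP0 : (P0 <= S)%MS.
  exact: submx_trans (submx_trans (addsmxSr _ _) (addsmxSl _ _)) (addsmxSl _ _).
have SP1 : (P1 <= S)%MS by rewrite /S -[(_ + v x1 + u1)%MS]addsmxA addsmxSr.
have Sa : (a x1 - a x0 <= S)%MS.
  exact: submx_trans (submx_trans (addsmxSl _ _) (addsmxSl _ _)) (addsmxSl _ _).
have [y0 y0b vy0] := escape pp pq' qq rS.
(* Lying outside [S] is an open condition: some coordinate of [v y *m cokermx S] is nonzero. *)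
have [p2 [q2 [le1 y02 le2 vS]]] : exists p2 q2 : R, [/\ p' <= p2, p2 < y0 < q2, q2 <= q' &
    forall y, p2 < y < q2 -> ~~ (v y <= S)%MS].
  have : v y0 *m cokermx S != 0 by rewrite -submxE.
  move=> /rV0Pn[l vl].
  have : \forall y \near y0, (v y *m cokermx S) 0 l != 0.
    have cvl : (fun y => (v y *m cokermx S) 0 l) @ y0 --> (v y0 *m cokermx S) 0 l.
      by apply: cvg_mulmx_coord; apply: cv; lra.
    exact: (cvgr_neq0 _ cvl vl).
  move=> /nbhs_ballP[/= e e0 He].
  exists (Num.max p' (y0 - e)), (Num.min q' (y0 + e)).
  have /andP[y1 y2] := y0b.
  rewrite le_max lexx ge_min lexx gt_max lt_min y1 y2 /=; split=> //.
    by rewrite gtrDl ltrDl oppr_lt0 e0.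
  move=> y; rewrite gt_max lt_min => /andP[/andP[_ l1] /andP[_ l2]].
  rewrite submxE; have := He y; rewrite /ball /= => He1.
  apply/negP => /eqP E0; have := He1 _; rewrite E0 mxE eqxx.
  by move=> H1; suff: false by []; apply: H1; rewrite ltr_distlC l1 l2.
(* The line at [y] meets each of the two planes. If the two points differed, their difference would
   put [v y] into [S]; hence they coincide. *)
have secant y : p2 < y < q2 -> exists c : R,
    (a y - c *: v y - a x0 <= P0)%MS /\ (a y - c *: v y - a x1 <= P1)%MS.
  move=> yb; have yb' : p' < y < q' by lra.
  have ybp : p < y < q by lra.
  have vyS := vS _ yb; have [s0 s1] := sy _ yb'.
  have nP0 : ~~ (v y <= P0)%MS by apply: contra vyS => /submx_trans; exact.
  have nP1 : ~~ (v y <= P1)%MS by apply: contra vyS => /submx_trans; exact.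
  have /sub_addsmxP[[B0 c0] /= E0] : (a y - a x0 <= P0 + v y)%MS.
    by apply: sub_adds_of_rank => //; rewrite rP0 dep0.
  have /sub_addsmxP[[B1 c1] /= E1] : (a y - a x1 <= P1 + v y)%MS.
    by apply: sub_adds_of_rank => //; rewrite rP1 dep1.
  rewrite [c0]mx11_scalar mul_scalar_mx in E0.
  rewrite [c1]mx11_scalar mul_scalar_mx in E1.
  have F0 : a y - c0 0 0 *: v y - a x0 = B0 *m P0 by rewrite addrAC E0 addrK.
  have F1 : a y - c1 0 0 *: v y - a x1 = B1 *m P1 by rewrite addrAC E1 addrK.
  have [Ec|nc] := eqVneq (c0 0 0) (c1 0 0).
    by exists (c0 0 0); rewrite F0 Ec F1 !submxMl.
  have cne : c1 0 0 - c0 0 0 != 0 by rewrite subr_eq0 eq_sym.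
  case/negP: vyS; rewrite -(eqmx_scale (v y) cne).
  have -> : (c1 0 0 - c0 0 0) *: v y = B0 *m P0 - B1 *m P1 - (a x1 - a x0).
    rewrite -F0 -F1 scalerBl; apply/rowP => l; rewrite !mxE; ring.
  rewrite !addmx_sub ?eqmx_opp //.
    exact: submx_trans (submxMl _ _) SP0.
  exact: submx_trans (submxMl _ _) SP1.
have [c0 [b0 b1]] := secant _ y02.
set b := a y0 - c0 *: v y0 in b0 b1.
(* Otherwise both planes have the same direction and share the point [b], so they coincide and
   contain the lines at [x0] and [x1], which are skew. *)
have cap1 : (\rank (P0 :&: P1)%MS <= 1)%N.
  rewrite leqNgt; apply/negP => r2.
  have E01 : (P0 :=: P1)%MS.
    apply/eqmxP/andP; split.
      have [_ E] := mxrank_leqif_sup (capmxSl P0 P1).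
      apply: submx_trans (capmxSr P0 P1); rewrite -E eqn_leq mxrankS ?capmxSl //=.
      by rewrite rP0.
    have [_ E] := mxrank_leqif_sup (capmxSr P0 P1).
    apply: submx_trans (capmxSl P0 P1); rewrite -E eqn_leq mxrankS ?capmxSr //=.
    by rewrite rP1.
  have v01 : (v x0 + v x1 <= P0)%MS.
    by rewrite addsmx_sub addsmxSl E01 addsmxSl.
  have a01 : (a x0 - a x1 <= P0)%MS.
    have -> : a x0 - a x1 = (b - a x1) - (b - a x0).
      by apply/rowP => l; rewrite !mxE; ring.
    by rewrite addmx_sub ?eqmx_opp // E01.
  have nv : ~~ (a x0 - a x1 <= v x0 + v x1)%MS /\ \rank (v x0 + v x1)%MS = 2%N.
    have /orP[lt|lt] : (x0 < x1) || (x1 < x0) by rewrite -neq_lt.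
      have [_ v10 an] := univ_indep px0 lt x1q; split=> //.
      by rewrite rank_adds_row // rank_rV vn0.
    have [_ v10 an] := univ_indep px1 lt x0q; split.
      by rewrite addsmxC -opprB eqmx_opp.
    by rewrite addsmxC rank_adds_row // rank_rV vn0.
  case: nv => /negP nv rv; apply: nv; apply: submx_trans a01 _.
  by have [_ <-] := mxrank_leqif_sup v01; rewrite rv rP0.
have [e Pe] := rank_le1_sub cap1.
apply: nontrivial; apply: (@common_secant_trivial p2 q2 b e); try lra.
move=> y /secant[c [d0 d1]].
have /sub_rVP[d Ed] : (a y - c *: v y - b <= e)%MS.
  apply: submx_trans Pe; rewrite sub_capmx.
  have -> : a y - c *: v y - b = (a y - c *: v y - a x0) - (b - a x0).
    by apply/rowP => l; rewrite !mxE; ring.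
  rewrite addmx_sub ?eqmx_opp //=.
  have -> : (a y - c *: v y - a x0) - (b - a x0) = (a y - c *: v y - a x1) - (b - a x1).
    by apply/rowP => l; rewrite !mxE; ring.
  by rewrite addmx_sub ?eqmx_opp.
by exists c, d; rewrite -Ed; apply/rowP => l; rewrite !mxE; ring.
Qed.

End LimitPlane.

(** [perm_between] is applied to [s^-1], which sends consecutive lines to their ranks in height. *)
Lemma universal_curves_trivial : p < q -> trivial.
Proof.
move=> pq; have [[s1|sr]|[i [i' [j [ii' H]]]]] := perm_between s^-1%g (ltnW (ltnW n4)).
- by left; rewrite -[s]invgK s1 invg1.
- right; rewrite -[s]invgK sr; apply/permP => i.
  by apply: (@perm_inj _ (perm (@rev_ord_inj n))); rewrite permKV !permE rev_ordK.
by apply: contrapT => nt; exact: (no_betweenness ii' H nt pq).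
Qed.

End UniversalCurves.

(** * From oriented lines to curves of feet and unit directions *)

Lemma height_normal_rep (R : realType) (n : nat) (P : 'I_n -> line_rep R n.+1) (i : 'I_n) :
  height (fun k => normal_rep (P k)) i =
  hdet (foot (P i))^T (fun k => (unit_dir (P k))^T).
Proof.
rewrite /height /hdet -det_tr; congr (\det _).
rewrite -[LHS]/((row_mx (foot (P i)) (\matrix_(k, j) unit_dir (P j) k 0))^T :
  'M[R]_(1 + n, n.+1)) tr_row_mx.
by apply: (f_equal2 (@col_mx R 1 n n.+1)) => //; apply/matrixP => k l; rewrite !mxE.
Qed.

(** Changing representatives multiplies all heights by one positive factor, so comparisons can be
    made on the normalized representatives. Those vary continuously along the family, which the
    chosen [repr] need not do. *)
Lemma line_height_normal (R : realType) (n : nat) (l : 'I_n -> oriented_line R n.+1)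
    (i j : 'I_n) :
  (line_height l i < line_height l j) =
  (hdet (foot (generic_quotient.repr (l i)))^T
     (fun k => (unit_dir (generic_quotient.repr (l k)))^T) <
   hdet (foot (generic_quotient.repr (l j)))^T
     (fun k => (unit_dir (generic_quotient.repr (l k)))^T)).
Proof.
have [c c0 E] := @height_same_line R n (fun k => generic_quotient.repr (l k))
  (fun k => normal_rep (generic_quotient.repr (l k)))
  (fun k => normal_rep_same_line (generic_quotient.repr (l k))).
by rewrite -!(height_normal_rep _ _ (fun k => generic_quotient.repr (l k))) !E ltr_pM2l.
Qed.

Theorem theorem10p1 (R : realType) (n : nat) (hd : (5 <= n.+1)%N)
    (I : set R) (Iopen : open I) (Iitv : is_interval I) (I0 : I !=set0)
    (L : R -> oriented_line R n.+1) (Lcont : {within I, continuous L})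
    (s : 'S_n) (Luniv : universal_of_type I L s) :
  s = 1%g \/ s = perm (@rev_ord_inj n).
Proof.
have [x0 Ix0] := I0.
(* A bounded interval around one point of [I] suffices, since every increasing tuple in it already
   has type [s]. *)
have /nbhs_ballP[/= e e0 He] : nbhs x0 I by exact: open_nbhs_nbhs.
have IpqI x : x0 - e < x < x0 + e -> I x.
  by move=> xb; apply: He; rewrite /ball /= ltr_distlC.
have [cf cu] := (oriented_line_continuousP (L : subspace I -> _)).1 Lcont.
have ctr (f : R -> 'cV[R]_n.+1) : {within I, continuous f} ->
    forall x, I x -> {for x, continuous (fun t => (f t)^T)}.
  move=> cf' x Ix; have H : {within I, continuous (fun t => (f t)^T)}.
    apply: mx_continuous => i j.
    rewrite (_ : (fun t => _) = (fun t => f t j i)).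
      exact: entry_continuous.
    by apply/funext => t; rewrite mxE.
  have E := continuous_open_subspace (fun t => (f t)^T) Iopen.
  by rewrite E in H; apply: H; exact: mem_set.
pose a t := (foot (generic_quotient.repr (L t)))^T.
pose v t := (unit_dir (generic_quotient.repr (L t)))^T.
have ca x : x0 - e < x < x0 + e -> {for x, continuous a}.
  by move=> /IpqI; exact: (ctr (fun t => foot (generic_quotient.repr (L t))) cf).
have cv x : x0 - e < x < x0 + e -> {for x, continuous v}.
  by move=> /IpqI; exact: (ctr (fun t => unit_dir (generic_quotient.repr (L t))) cu).
have univ (t : 'I_n -> R) : (forall i, x0 - e < t i < x0 + e) -> increasing t ->
    forall i j : 'I_n, (i < j)%N ->
    hdet (a (t (s i))) (v \o t) < hdet (a (t (s j))) (v \o t).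
  move=> tb ti i j ij; have [_ /(_ i j ij)] := Luniv t (fun k => IpqI _ (tb k)) ti.
  by rewrite line_height_normal.
by apply: (universal_curves_trivial hd ca cv univ); lra.
Qed.
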